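(* Let $X$ be a discrete topological space, let $S$ be a non-empty set, and let $I$ and $K$ be admissible ideals on $S$. Then $I^K$-convergence and $I^{K^*}$-convergence coincide: for every function $f:S\to X$ and every $x\in X$, $f$ is $I^K$-convergent to $x$ if and only if $f$ is $I^{K^*}$-convergent to $x$.
   Context: An ideal on a non-empty set $S$ is a family $I\subset 2^S$ closed under finite unions and under taking subsets. It is non-trivial if $S\notin I$ and $I\neq\{\emptyset\}$. A non-trivial ideal on $S$ is admissible if it contains every singleton $\{s\}$, $s\in S$. The associated filter is $F(I)=\{A\subset S: S\setminus A\in I\}$. $\mathrm{Fin}(S)$ is the ideal of all finite subsets of $S$. For an ideal $J$ on $S$, a function $g:S\to X$ is $J$-convergent to $x$ if $\{s\in S: g(s)\notin U\}\in J$ for every neighborhood $U$ of $x$. A function $f:S\to X$ is $I^K$-convergent to $x$ if there is $M\in F(I)$ such that the function $g$ given by $g(s)=f(s)$ for $s\in M$, $g(s)=x$ for $s\notin M$, is $K$-convergent to $x$. A function $f:S\to X$ is $I^{K^*}$-convergent to $x$ if there are $M\in F(I)$ and $M_1\in F(K)$ such that the function $g$ given by $g(s)=f(s)$ for $s\in M\cap M_1$, $g(s)=x$ for $s\notin M\cap M_1$, is $\mathrm{Fin}(S)$-convergent to $x$. *)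

(* Defs.v *)
From mathcomp Require Import all_boot.
From mathcomp Require Import boolp classical_sets functions cardinality filter.
From mathcomp Require Import topology.

Set Implicit Arguments.
Unset Strict Implicit.
Unset Printing Implicit Defensive.

Local Open Scope classical_set_scope.

(* Closure under finite unions is closure under binary unions together with
   membership of the empty union [set0]. *)
Record is_ideal (S : Type) (I : set_system S) : Prop := IsIdeal {
  ideal_set0 : I set0;
  ideal_setU : forall A B : set S, I A -> I B -> I (A `|` B);
  ideal_sub : forall A B : set S, A `<=` B -> I B -> I A }.

Record nontrivial_ideal (S : Type) (I : set_system S) : Prop :=
  NontrivialIdeal {
  nontrivial_is_ideal : is_ideal I;
  nontrivial_setT : ~ I [set: S];
  nontrivial_neq0 : I <> [set set0] }.

Record admissible_ideal (S : Type) (I : set_system S) : Prop :=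
  AdmissibleIdeal {
  admissible_nontrivial : nontrivial_ideal I;
  admissible_set1 : forall s : S, I [set s] }.

Definition assoc_filter (S : Type) (I : set_system S) : set_system S :=
  [set A | I (~` A)].

Definition Fin (S : Type) : set_system S := [set A | finite_set A].

Definition ideal_cvg (S : Type) (X : topologicalType) (J : set_system S)
    (g : S -> X) (x : X) : Prop :=
  forall U : set X, nbhs x U -> J [set s | ~ U (g s)].

(* [patch (cst x) M f] is [f] on [M] and the constant [x] off [M]. *)
Definition IK_cvg (S : Type) (X : topologicalType) (I K : set_system S)
    (f : S -> X) (x : X) : Prop :=
  exists2 M : set S, assoc_filter I M & ideal_cvg K (patch (cst x) M f) x.

Definition IKstar_cvg (S : Type) (X : topologicalType) (I K : set_system S)
    (f : S -> X) (x : X) : Prop :=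
  exists M M1 : set S, [/\ assoc_filter I M, assoc_filter K M1 &
    ideal_cvg (@Fin S) (patch (cst x) (M `&` M1) f) x].

(* Main.v *)
Require Import Defs.
From mathcomp Require Import all_boot.
From mathcomp Require Import boolp classical_sets functions cardinality filter.
From mathcomp Require Import topology.

Local Open Scope classical_set_scope.

(** If [f] is [I^K]-convergent to [x] along [M], discreteness makes [{x}] a
    neighborhood of [x], so the set of all points of [M] where [f] differs
    from [x] is a single member of [K]. Discarding it leaves the function that
    is constantly [x], which is [Fin]-convergent: its exceptional sets are
    empty, not merely finite ([IK_cvg_IKstar_cvg]).

    Conversely, in every topological space, an exceptional set for [f]
    restricted to [M] splits into its part in [M1], which is finite, and its
    part outside [M1], which is in [K]. A finite set is in [K] because [K] is
    closed under finite unions and contains the singletons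
    ([ideal_finite_set]), so the whole
    exceptional set is in [K] ([IKstar_cvg_IK_cvg]). *)

Lemma ideal_finite_set (S : Type) (K : set_system S) :
  is_ideal K -> (forall s, K [set s]) -> @Fin S `<=` K.
Proof.
elim/Pchoice: S => S in K *.
move=> K_ideal K_set1 A /finite_seqP[r ->] {A}.
elim: r => [|s r IHr].
  by rewrite set_nil; exact: (ideal_set0 K_ideal).
apply: (ideal_sub K_ideal) (ideal_setU K_ideal (K_set1 s) IHr) => t /=.
by rewrite inE => /predU1P[->|]; [left|right].
Qed.

Lemma IK_cvg_IKstar_cvg (X : discreteTopologicalType) (S : Type)
    (I K : set_system S) (f : S -> X) (x : X) :
  IK_cvg I K f x -> IKstar_cvg I K f x.
Proof.
case=> M I_M cvgK.
exists M, [set s | patch (cst x) M f s = x]; split=> //.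
  exact: cvgK (discrete_set1 x).
move=> U U_x; rewrite (_ : [set s | _] = set0); first exact: finite_set0.
rewrite -subset0 => s /=; apply.
rewrite /patch; case: ifPn => [|_]; last exact: nbhs_singleton.
rewrite inE => -[M_s] /=.
by rewrite mem_set// => ->; exact: nbhs_singleton.
Qed.

Lemma IKstar_cvg_IK_cvg (X : topologicalType) (S : Type)
    (I K : set_system S) (f : S -> X) (x : X) :
  admissible_ideal K -> IKstar_cvg I K f x -> IK_cvg I K f x.
Proof.
case=> -[K_ideal _ _] K_set1 [M [M1 [I_M K_M1 cvgFin]]].
exists M => // U U_x.
have K_fin := ideal_finite_set _ _ K_ideal K_set1 _ (cvgFin U U_x).
apply: (ideal_sub K_ideal) (ideal_setU K_ideal K_fin K_M1) => s /= nU_s.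
have [M1_s|] := pselect (M1 s); [left => /=|by right].
by move: nU_s; rewrite /patch in_setI (mem_set M1_s) andbT.
Qed.

Theorem theorem4p1 (X : discreteTopologicalType) (S : Type)
    (S_nonempty : [set: S] !=set0) (I K : set_system S)
    (I_adm : admissible_ideal I) (K_adm : admissible_ideal K)
    (f : S -> X) (x : X) :
  IK_cvg I K f x <-> IKstar_cvg I K f x.
Proof.
split; first exact: IK_cvg_IKstar_cvg.
exact: IKstar_cvg_IK_cvg.
Qed.
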